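(* Let $a$ be a nonzero real constant. For $i=1,\ldots,N$, the residual $$u(t) = -a\,\frac{z_{i} - e^{a(t_i-t_{i-1})} z_{i-1}}{1 - e^{a(t_i-t_{i-1})}} =: \overline{u}^{[i]},$$ for all $t\in[t_{i-1},t_i]$, solves Problem (PLinf) with $f(x(t),t)=a\,x(t)$. The resulting interpolant is given by $$x(t) = \left(z_{i-1} + \frac{\overline{u}^{[i]}}{a}\right)e^{a(t-t_{i-1})} - \frac{\overline{u}^{[i]}}{a},$$ for all $t\in[t_{i-1},t_i]$.
   Context: Let $0=t_0<t_1<\cdots<t_N=:t_f$ and let $z_0,\ldots,z_N\in\mathbb{R}$ (the skeleton) satisfy $z_i\ne z_{i-1}$, $i=1,\ldots,N$. The underlying ODE is the Dahlquist test problem $\dot z(t)=a\,z(t)$, $z(0)=z_0$. Problem (PLinf) for scalar $f$: minimize $\sum_{i=1}^N\max_{t_{i-1}\le t\le t_i}|u(t)|$ (the maximum over each stage understood as the essential supremum) over $x\in W^{1,\infty}(t_0,t_f;\mathbb{R})$ and $u\in L^\infty(t_0,t_f;\mathbb{R})$ subject to $\dot x(t)=f(x(t),t)+u(t)$ for a.e. $t\in[t_0,t_f]$ and $x(t_i)=z_i$, $i=0,\ldots,N$. The residual $u=\dot x-f(x,t)$ may jump at the nodes $t_1,\ldots,t_{N-1}$; the formulas are to be read separately on each stage $[t_{i-1},t_i]$. *)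

(* Defs.v *)
From HB Require Import structures.
From mathcomp Require Import all_boot all_order all_algebra.
From mathcomp Require Import all_classical all_reals all_analysis ess_sup_inf.

Set Implicit Arguments.
Unset Strict Implicit.
Unset Printing Implicit Defensive.

Import Order.TTheory GRing.Theory Num.Theory.
Import numFieldNormedType.Exports.

Local Open Scope classical_set_scope.
Local Open Scope ring_scope.

(* Essential supremum of |u| over the interval i. *)
Definition ess_norm (R : realType) (i : interval R) (u : R -> R) : \bar R :=
  ess_sup (mrestr (@lebesgue_measure R) (measurable_itv i))
    (fun s => `|u s|%:E).

(* L^infty(i), on representatives: only the values of u on i matter. The
   library's Lebesgue measure lives on the Borel sets, so representatives are
   Borel; every class of Lebesgue measurable functions has a Borel one. *)
Definition Linfty (R : realType) (i : interval R) (u : R -> R) : Prop :=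
  measurable_fun [set` i] u /\
  (ess_norm i u < +oo)%E.

(* Test functions: C^1 with compact support in ]b, c[, as is customary for
   Sobolev spaces on an interval (Brezis, Functional Analysis, Sobolev Spaces
   and PDE, section 8.2). *)
Definition test_function (R : realType) (b c : R) (phi : R -> R) : Prop :=
  [/\ forall s, derivable phi s 1,
      continuous (derive1 phi),
      compact (closure [set s | phi s != 0]) &
      closure [set s | phi s != 0] `<=` `]b, c[].

Definition weak_derivative (R : realType) (b c : R) (x v : R -> R) : Prop :=
  forall phi : R -> R, test_function b c phi ->
    \int[lebesgue_measure]_(s in `]b, c[) (x s * derive1 phi s) =
    - \int[lebesgue_measure]_(s in `]b, c[) (v s * phi s).

(* x belongs to W^{1,infty}(b, c) and has (weak) derivative v. An element of
   W^{1,infty}(b, c) is identified with its continuous representative on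
   [b, c], so that its values at points, end points included, make sense. *)
Definition W1infty_deriv (R : realType) (b c : R) (x v : R -> R) : Prop :=
  [/\ {within `[b, c], continuous x},
      Linfty `]b, c[ x,
      Linfty `]b, c[ v &
      weak_derivative b c x v].

(* The feasible pairs (x, u) of the problem with nodes t 0 < ... < t N and
   skeleton z 0, ..., z N; t k and z k are irrelevant for k > N. *)
Definition PLinf_feasible (R : realType) (f : R -> R -> R) (N : nat)
    (t z : nat -> R) (x u : R -> R) : Prop :=
  [/\ exists2 xdot : R -> R,
        W1infty_deriv (t 0%N) (t N) x xdot &
        {ae @lebesgue_measure R, forall s, s \in `[t 0%N, t N] ->
           xdot s = f (x s) s + u s},
      Linfty `]t 0%N, t N[ u &
      forall i, (i <= N)%N -> x (t i) = z i].

Definition PLinf_cost (R : realType) (N : nat) (t : nat -> R) (u : R -> R)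
    : \bar R :=
  (\sum_(i < N) ess_norm `[t i, t i.+1] u)%E.

Definition PLinf_solution (R : realType) (f : R -> R -> R) (N : nat)
    (t z : nat -> R) (x u : R -> R) : Prop :=
  PLinf_feasible f N t z x u /\
  forall y v : R -> R, PLinf_feasible f N t z y v ->
    (PLinf_cost N t u <= PLinf_cost N t v)%E.

(* Stages are numbered from 0: stage i is [t i, t i.+1]. *)
Definition stage_residual (R : realType) (a : R) (t z : nat -> R) (i : nat)
    : R :=
  - a * ((z i.+1 - expR (a * (t i.+1 - t i)) * z i)
         / (1 - expR (a * (t i.+1 - t i)))).

Definition stage_interpolant (R : realType) (a : R) (t z : nat -> R) (i : nat)
    (s : R) : R :=
  (z i + stage_residual a t z i / a) * expR (a * (s - t i))
  - stage_residual a t z i / a.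

(* Main.v *)
(* Let (x, v) be feasible, so that the weak derivative of x is a x + v. If
   k v <= M a.e. on [l, r], with k = 1 or -1, then (k x + M / a) e^(- a s) has
   a nonpositive weak derivative on [l, r], hence is nonincreasing there:
     k (x(r) - e^(a (r - l)) x(l)) <= M (e^(a (r - l)) - 1) / a.
   On a whole stage the left-hand side is k ubar (e^(a (r - l)) - 1) / a, so
   |ubar| <= ess sup |v|, stage by stage. When v = ubar, taking M = k ubar for
   both signs gives equality, i.e. the formula for x. The glued formulas are
   feasible because the boundary terms of the integrations by parts over the
   stages telescope. *)

Require Import Defs.
From HB Require Import structures.
From mathcomp Require Import all_boot all_order all_algebra.
From mathcomp Require Import all_classical all_reals all_analysis.
From mathcomp Require Import ess_sup_inf measurable_realfun ring lra.

Set Implicit Arguments.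
Unset Strict Implicit.
Unset Printing Implicit Defensive.

Import Order.TTheory GRing.Theory Num.Theory.
Import numFieldNormedType.Exports.

Local Open Scope classical_set_scope.
Local Open Scope ring_scope.

(** * Pointwise calculus on the real line *)

Lemma is_derive1_continuous (R : realType) (F f : R -> R) :
  (forall s : R, is_derive s 1 F (f s)) -> continuous F.
Proof.
move=> dF s; apply/differentiable_continuous/derivable1_diffP.
by have [] := dF s.
Qed.

Lemma is_derive1M (R : realType) (F G : R -> R) (f g s : R) :
  is_derive s 1 F f -> is_derive s 1 G g ->
  is_derive s 1 (fun r => F r * G r) (F s * g + f * G s).
Proof.
move=> dF dG; apply: is_derive_eq (is_deriveM dF dG) _.
by rewrite /GRing.scale/= [f * _]mulrC.
Qed.

Lemma continuousMf (R : realType) (f g : R -> R) :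
  continuous f -> continuous g -> continuous (fun s => f s * g s).
Proof. by move=> cf cg s; apply: cvgM; [exact: cf|exact: cg]. Qed.

Lemma continuousDf (R : realType) (f g : R -> R) :
  continuous f -> continuous g -> continuous (fun s => f s + g s).
Proof. by move=> cf cg s; apply: cvgD; [exact: cf|exact: cg]. Qed.

(** * Essential bounds and integrability on bounded intervals *)

(** A measurable set is null for the restricted measure exactly when its trace on [i] is Lebesgue
    null. The bound [M] is extended because the essential supremum is [-oo] on a negligible
    interval. *)
Lemma ess_normP (R : realType) (i : interval R) (u : R -> R) (M : \bar R) :
  (ess_norm i u <= M)%E <->
  {ae @lebesgue_measure R, forall s, s \in i -> (`|u s|%:E <= M)%E}.
Proof.
rewrite /ess_norm; split => [/ess_supP[A [mA A0 sA]]|[A [mA A0 sA]]].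
- exists (A `&` [set` i]); split=> //.
    by apply: measurableI => //; exact: measurable_itv.
  move=> s /= /not_implyP[si us]; split => //; exact: sA.
- apply/ess_supP; exists (A `|` ~` [set` i]); split=> /=.
  + by apply: measurableU => //; apply: measurableC; exact: measurable_itv.
  + rewrite /mrestr setIUl setICl setU0; apply/eqP.
    rewrite -measure_le0 -A0 le_measure ?inE//.
    by apply: measurableI => //; exact: measurable_itv.
  + move=> s /= us; have [si|/negP si] := boolP (s \in i); last by right.
    by left; apply: sA => /= h; apply: us; exact: h.
Qed.

Lemma Linfty_integrable (R : realType) (b c : R) (f : R -> R) :
  Linfty `]b, c[ f -> (@lebesgue_measure R).-integrable `]b, c[ (EFin \o f).
Proof.
move=> [mf noo].
have [M fM] : exists M : R,
    {ae @lebesgue_measure R, forall s, s \in `]b, c[ -> (`|f s|%:E <= M%:E)%E}.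
  (* If the essential norm is [-oo], [fine] returns 0, which still bounds it from above. *)
  exists (fine (ess_norm `]b, c[ f)); apply/ess_normP.
  by move: noo; case: (ess_norm _ _) => [r| |]//= _; rewrite leNye.
apply/integrableP; split; first exact/measurable_EFinP.
apply: (@le_lt_trans _ _ (\int[lebesgue_measure]_(s in `]b, c[) `|M|%:E)%E).
  apply: ae_ge0_le_integral => //.
  - by apply: measurableT_comp => //; exact/measurable_EFinP.
  - apply: (filterS (Filter := ae_filter_ringOfSetsType _)) fM => s.
    move=> /[apply]; rewrite /= !lee_fin => /le_trans -> //.
    exact: ler_norm.
rewrite integral_cst//= lte_mul_pinfty// lebesgue_measure_itv/=.
by case: ifP => //; rewrite -EFinB ltry.
Qed.

(** The continuous factor is bounded on the compact interval [[b, c]], whichever end points belong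
    to [D]. *)
Lemma integrable_mul_continuous (R : realType) (b c : R) (b0 b1 : bool)
    (f g : R -> R) :
  let D := [set` Interval (BSide b0 b) (BSide b1 c)] in
  (@lebesgue_measure R).-integrable D (EFin \o f) -> continuous g ->
  (@lebesgue_measure R).-integrable D (EFin \o (fun s => f s * g s)).
Proof.
move=> D fi cg; have mD : measurable D by exact: measurable_itv.
have -> : EFin \o (fun s => f s * g s) = ((EFin \o f) \* (EFin \o g))%E.
  by apply/funext => s /=.
apply: integrableMl => //.
  by apply: measurable_funTS; exact: continuous_measurable_fun.
have : bounded_set (g @` `[b, c]).
  apply: compact_bounded; apply: continuous_compact; last exact: segment_compact.
  exact: continuous_subspaceT.
move=> [M [Mr HM]]; exists M; split=> // r Mr' s /= sbc; apply: (HM r) => //.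
exists s => //; apply: subset_itvScc sbc.
  by case: (b0); rewrite bnd_simp.
by case: (b1); rewrite bnd_simp.
Qed.

Lemma continuous_integrable (R : realType) (b c : R) (b0 b1 : bool) (g : R -> R) :
  let D := [set` Interval (BSide b0 b) (BSide b1 c)] in
  continuous g ->
  (@lebesgue_measure R).-integrable D (EFin \o g).
Proof.
move=> D cg; have mD : measurable D by exact: measurable_itv.
have := @integrable_mul_continuous R b c b0 b1 (cst 1) g.
have -> : (fun s => cst 1 s * g s) = g by apply/funext => s /=; rewrite mul1r.
apply=> //; apply/integrableP; split; first exact/measurable_EFinP.
rewrite /= normr1 integral_cst//= mul1e lebesgue_measure_itv/=.
by case: ifP => //; rewrite -EFinB ltry.
Qed.

Lemma integrable_add (R : realType) (b c : R) (b0 b1 : bool) (f g : R -> R) :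
  let D := [set` Interval (BSide b0 b) (BSide b1 c)] in
  (@lebesgue_measure R).-integrable D (EFin \o f) ->
  (@lebesgue_measure R).-integrable D (EFin \o g) ->
  (@lebesgue_measure R).-integrable D (EFin \o (fun s => f s + g s)).
Proof.
move=> D fi gi; have mD : measurable D by exact: measurable_itv.
exact: (integrableD _ fi gi).
Qed.

Lemma Rintegral_is_derive (R : realType) (b c : R) (F f : R -> R) : b < c ->
  (forall s : R, is_derive s 1 F (f s)) -> continuous f ->
  \int[lebesgue_measure]_(s in `]b, c[) f s = F c - F b.
Proof.
move=> bc dF cf.
have cF := is_derive1_continuous dF.
(* The fundamental theorem of calculus is applied on the closed interval; adding the end points does
   not change the integral. *)
rewrite /Rintegral -(@integral_itv_bndoo _ _ _ _ true false)//.
  rewrite (@continuous_FTC2 _ f F)//.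
  - exact: continuous_subspaceT.
  - split; first by move=> s _; have [] := dF s.
      exact/cvg_at_right_filter/cF.
    exact/cvg_at_left_filter/cF.
  - by move=> s _; rewrite derive1E; have [_ ->] := dF s.
apply/measurable_EFinP; apply: measurable_funTS.
exact: continuous_measurable_fun.
Qed.

(** * Test functions and the product rule for weak derivatives *)

(** The support of the product lies in that of [phi]. A $C^1$ factor of [x] can therefore be moved
    into the test function. *)
Lemma test_functionM (R : realType) (b c : R) (E e phi : R -> R) :
  (forall s : R, is_derive s 1 E (e s)) -> continuous e ->
  test_function b c phi -> test_function b c (fun s => E s * phi s).
Proof.
move=> dE ce [dphi cphi kphi sphi].
have cE := is_derive1_continuous dE.
have dphi' (s : R) : is_derive s 1 phi (phi^`()%classic s).
  by rewrite derive1E; apply: derivableP.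
have cp := is_derive1_continuous dphi'.
have d (s : R) := is_derive1M (dE s) (dphi' s).
have sub : closure [set s | E s * phi s != 0] `<=` closure [set s | phi s != 0].
  apply: closureS => s /=; apply: contra => /eqP ->; by rewrite mulr0.
split.
- by move=> s; have [] := d s.
- have -> : derive1 (fun s => E s * phi s) =
      (fun s => E s * phi^`()%classic s + e s * phi s).
    by apply/funext => s; rewrite derive1E; have [_ ->] := d s.
  by apply: continuousDf; exact: continuousMf.
- by apply: subclosed_compact sub => //; exact: closed_closure.
- exact: subset_trans sub sphi.
Qed.

Lemma test_function_eq0 (R : realType) (b c : R) (phi : R -> R) (s : R) :
  test_function b c phi -> s \notin `]b, c[ -> phi s = 0.
Proof.
move=> [_ _ _ sub] /negP ns; apply/eqP/negPn/negP => h; apply: ns.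
by apply: sub; exact: subset_closure.
Qed.

(** The weak derivative of [x] is tested with [E phi], where [(E phi)' = E phi' + e phi]; the $C^1$
    summand [H] is integrated by parts classically. *)
Lemma weak_derivative_affine (R : realType) (b c : R) (x v E e H h : R -> R) :
  b < c ->
  (forall s : R, is_derive s 1 E (e s)) -> continuous e ->
  (forall s : R, is_derive s 1 H (h s)) -> continuous h ->
  (@lebesgue_measure R).-integrable `]b, c[ (EFin \o x) ->
  (@lebesgue_measure R).-integrable `]b, c[ (EFin \o v) ->
  weak_derivative b c x v ->
  weak_derivative b c (fun s => x s * E s + H s)
                      (fun s => v s * E s + x s * e s + h s).
Proof.
move=> bc dE ce dH ch xi vi xv phi tphi; have [dphi cphi _ _] := tphi.
have cE := is_derive1_continuous dE.
have cH := is_derive1_continuous dH.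
have dphi' (s : R) : is_derive s 1 phi (phi^`()%classic s).
  by rewrite derive1E; apply: derivableP.
have cp := is_derive1_continuous dphi'.
(* The integrand is [(H phi)'], and [phi] vanishes at both end points. *)
have iH : \int[lebesgue_measure]_(s in `]b, c[)
    (H s * phi^`()%classic s + h s * phi s) = 0.
  have /(@Rintegral_is_derive _ _ _ _ _ bc) -> :=
    fun s : R => is_derive1M (dH s) (dphi' s).
    by rewrite !(test_function_eq0 tphi) ?in_itv/= ?ltxx ?andbF// !mulr0 subrr.
  by apply: continuousDf; exact: continuousMf.
have := xv _ (test_functionM dE ce tphi).
have -> : (fun s => E s * phi s)^`()%classic =
    (fun s => E s * phi^`()%classic s + e s * phi s).
  apply/funext => s; rewrite derive1E.
  by have [_ ->] := is_derive1M (dE s) (dphi' s).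
have I1 : (@lebesgue_measure R).-integrable `]b, c[
    (EFin \o (fun s => x s * (E s * phi^`()%classic s + e s * phi s))).
  apply: integrable_mul_continuous => //.
  by apply: continuousDf; exact: continuousMf.
have I2 : (@lebesgue_measure R).-integrable `]b, c[
    (EFin \o (fun s => v s * (E s * phi s))).
  by apply: integrable_mul_continuous => //; exact: continuousMf.
have I3 : (@lebesgue_measure R).-integrable `]b, c[
    (EFin \o (fun s => x s * (e s * phi s))).
  by apply: integrable_mul_continuous => //; exact: continuousMf.
have I4 : (@lebesgue_measure R).-integrable `]b, c[
    (EFin \o (fun s => H s * phi^`()%classic s)).
  by apply: continuous_integrable; exact: continuousMf.
have I5 : (@lebesgue_measure R).-integrable `]b, c[
    (EFin \o (fun s => h s * phi s)).
  by apply: continuous_integrable; exact: continuousMf.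
have I6 : (@lebesgue_measure R).-integrable `]b, c[
    (EFin \o (fun s => x s * (E s * phi^`()%classic s))).
  by apply: integrable_mul_continuous => //; exact: continuousMf.
(* The flags [false] and [true] make the interval open at both ends. *)
have add := @integrable_add R b c false true.
have -> : \int[lebesgue_measure]_(s in `]b, c[)
    (x s * (E s * phi^`()%classic s + e s * phi s)) =
  \int[lebesgue_measure]_(s in `]b, c[) (x s * (E s * phi^`()%classic s)) +
  \int[lebesgue_measure]_(s in `]b, c[) (x s * (e s * phi s)).
  by rewrite -RintegralD//; apply: eq_Rintegral => s _; rewrite mulrDr.
move: iH; rewrite RintegralD// => iH eqx.
have -> : \int[lebesgue_measure]_(s in `]b, c[)
    ((x s * E s + H s) * phi^`()%classic s) =
  \int[lebesgue_measure]_(s in `]b, c[) (x s * (E s * phi^`()%classic s)) +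
  \int[lebesgue_measure]_(s in `]b, c[) (H s * phi^`()%classic s).
  by rewrite -RintegralD//; apply: eq_Rintegral => s _; rewrite mulrDl mulrA.
have -> : \int[lebesgue_measure]_(s in `]b, c[)
    ((v s * E s + x s * e s + h s) * phi s) =
  \int[lebesgue_measure]_(s in `]b, c[) (v s * (E s * phi s)) +
  \int[lebesgue_measure]_(s in `]b, c[) (x s * (e s * phi s)) +
  \int[lebesgue_measure]_(s in `]b, c[) (h s * phi s).
  rewrite -RintegralD// -RintegralD//; last exact: add.
  by apply: eq_Rintegral => s _; ring.
lra.
Qed.

(** * $C^1$ cutoff functions, and monotonicity from the sign of a weak derivative *)

(** The difference quotient is within [|h|] of [2 * Num.max 0 s]; this is a polynomial inequality
    for each choice of signs of [s] and [h + s]. *)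
Lemma is_derive_sqr_pos (R : realType) (s : R) :
  is_derive s 1 (fun r => Num.max 0 r ^+ 2) (2 * Num.max 0 s).
Proof.
suff cvgl : (fun h => h^-1 *: (((fun r => Num.max 0 r ^+ 2) \o shift s) (h *: 1)
      - Num.max 0 s ^+ 2)) @ 0^' --> 2 * Num.max 0 s.
  apply: DeriveDef; first by apply/cvg_ex; exists (2 * Num.max 0 s).
  exact/cvg_lim.
apply/cvgrPdist_le => e e0; near=> h.
have h0 : h != 0 by near: h; exact: nbhs_dnbhs_neq.
have he : `|h| <= e by near: h; exact: dnbhs0_le.
apply: le_trans he; rewrite /= /GRing.scale/= mulr1.
have -> : 2 * Num.max 0 s - h^-1 * (Num.max 0 (h + s) ^+ 2 - Num.max 0 s ^+ 2) =
    h^-1 * (2 * Num.max 0 s * h - (Num.max 0 (h + s) ^+ 2 - Num.max 0 s ^+ 2)).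
  by field.
rewrite normrM normfV ler_pdivrMl ?normr_gt0// -expr2 real_normK ?num_real//.
by case: (lerP 0 s) => s0; case: (lerP 0 (h + s)) => hs0; rewrite ler_norml; nra.
Unshelve. all: by end_near. Qed.

(* The quadratic spline given by the second difference of max(0, s)^2. *)
Lemma C1_step (R : realType) (m h : R) : 0 < h ->
  exists S g : R -> R,
    [/\ forall s : R, is_derive s 1 S (g s), continuous g,
        forall s, 0 <= g s, forall s, 0 <= S s <= 1 &
        (forall s, s <= m - h -> S s = 0 /\ g s = 0) /\
        (forall s, m + h <= s -> S s = 1 /\ g s = 0)].
Proof.
move=> h0.
pose P (s : R) := Num.max 0 s.
(* Beyond [m + h] the second difference is constantly [2 * h ^+ 2], hence the denominator. *)
exists (fun s => (P (s - m + h) ^+ 2 - 2 * P (s - m) ^+ 2 + P (s - m - h) ^+ 2)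
                 / (2 * h ^+ 2)).
(* The slope is the tent of height [1 / h] on [[m - h, m + h]], of area 1. *)
exists (fun s => (P (s - m + h) - 2 * P (s - m) + P (s - m - h)) / h ^+ 2).
have h2 : 0 < h ^+ 2 by rewrite exprn_gt0.
have PS (s k : R) : is_derive s 1 (fun r => P (r + k) ^+ 2) (2 * P (s + k)).
  have d : is_derive s 1 (fun r : R => r + k) 1.
    by apply: is_derive_eq; rewrite addr0.
  have := @is_derive1_comp _ (fun r => Num.max 0 r ^+ 2) (fun r => r + k) s
    _ _ (is_derive_sqr_pos (s + k)) d.
  by rewrite mulr1.
have cP k : continuous (fun s => P (s + k)).
  move=> s; apply: (@continuous_max _ _ (fun=> 0) (fun r => r + k) s).
    exact: cvg_cst.
  by apply: cvgD; [exact: cvg_id|exact: cvg_cst].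
have PE (s : R) : (0 <= s /\ P s = s) \/ (s <= 0 /\ P s = 0).
  by rewrite /P; case: (lerP 0 s) => [|/ltW]; [left|right].
split=> [s| |s|s|].
- have -> : (fun s => (P (s - m + h) ^+ 2 - 2 * P (s - m) ^+ 2 + P (s - m - h) ^+ 2)
       / (2 * h ^+ 2)) =
     (fun s => (P (s + (h - m)) ^+ 2 + (-2) * P (s + (- m)) ^+ 2
       + P (s + (- h - m)) ^+ 2) * (2 * h ^+ 2)^-1).
    apply/funext => r; congr (_ / _).
    rewrite (_ : r - m + h = r + (h - m)); last by ring.
    rewrite (_ : r - m - h = r + (- h - m)); last by ring.
    by ring.
  have d1 := PS s (h - m); have d2 := PS s (- m); have d3 := PS s (- h - m).
  have dc (k : R) : is_derive s 1 (fun=> k) 0 by exact: is_derive_cst.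
  have H := is_derive1M (is_deriveD (is_deriveD d1 (is_derive1M (dc (-2)) d2)) d3)
             (dc (2 * h ^+ 2)^-1).
  apply: (is_derive_eq H).
  rewrite (_ : s - m + h = s + (h - m)); last by ring.
  rewrite (_ : s - m - h = s + (- h - m)); last by ring.
  by rewrite mulr0 add0r; field; rewrite gt_eqF.
- apply: continuousMf; last exact: cst_continuous.
  have -> : (fun s => P (s - m + h) - 2 * P (s - m) + P (s - m - h)) =
     (fun s => P (s + (h - m)) + (-2) * P (s + (- m)) + P (s + (- h - m))).
    apply/funext => r.
    rewrite (_ : r - m + h = r + (h - m)); last by ring.
    rewrite (_ : r - m - h = r + (- h - m)); last by ring.
    by ring.
  apply: continuousDf => //; apply: continuousDf => //.
  by apply: continuousMf => //; exact: cst_continuous.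
- apply: divr_ge0; last exact: ltW.
  by have [[]|[]] := PE (s - m + h); have [[]|[]] := PE (s - m);
     have [[]|[]] := PE (s - m - h); lra.
- rewrite ler_pdivlMr ?ler_pdivrMr; [|nra|nra].
  by have [[? ->]|[? ->]] := PE (s - m + h); have [[? ->]|[? ->]] := PE (s - m);
     have [[? ->]|[? ->]] := PE (s - m - h); nra.
- have hn : h != 0 by rewrite gt_eqF.
  have P0 (r : R) : r <= 0 -> P r = 0 by rewrite /P => /max_idPl.
  have P1 (r : R) : 0 <= r -> P r = r by rewrite /P => /max_idPr.
  split=> s sm.
    by rewrite !P0; [split; field|lra..].
  by rewrite !P1; [split; field|lra..].
Qed.

Lemma is_derive1Zl (R : realType) (F : R -> R) (k f s : R) :
  is_derive s 1 F f -> is_derive s 1 (fun r => k * F r) (k * f).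
Proof.
move=> dF; apply: (is_derive_eq (is_derive1M (is_derive_cst (k : R^o) s 1) dF)).
by rewrite mul0r addr0.
Qed.

(** The plateau is [S1 - S2], a step up near [l] minus a step up near [r]. The two steps are
    returned separately so that the rising and falling slopes can be estimated one by one. *)
Lemma C1_plateau (R : realType) (l r d : R) : l < r -> 0 < d ->
  exists (h : R) (S1 g1 S2 g2 : R -> R), 0 < h /\
    [/\ (forall s : R, is_derive s 1 S1 (g1 s)) /\
          (forall s : R, is_derive s 1 S2 (g2 s)),
        continuous g1 /\ continuous g2,
        (forall s, 0 <= g1 s /\ (g1 s != 0 -> l < s < l + d)) /\
          (forall s, 0 <= g2 s /\ (g2 s != 0 -> r - d < s < r)),
        forall s, 0 <= S1 s - S2 s /\ (S1 s - S2 s != 0 -> l + h <= s <= r - h) &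
        (forall s, s <= l -> S1 s = 0 /\ S2 s = 0) /\
          (forall s, r <= s -> S1 s = 1 /\ S2 s = 1)].
Proof.
move=> lr d0.
(* The ramps will occupy [[l + h, l + 3 * h]] and [[r - 3 * h, r - h]]: [6 * h <= r - l] keeps them
   from overlapping, and [6 * h <= d] keeps them within [d] of the end points. *)
have [h h0 [h1 h3]] : exists2 h : R, 0 < h & 6 * h <= d /\ 6 * h <= r - l.
  exists (Num.min d (r - l) / 6).
    by rewrite divr_gt0// !lt_min d0 subr_gt0 lr.
  have -> : 6 * (Num.min d (r - l) / 6) = Num.min d (r - l) by field.
  by rewrite !ge_min !lexx ?orbT.
have [S1 [g1 [dS1 cg1 g10 S101 [S10 S11]]]] := C1_step (l + 2 * h) h0.
have [S2 [g2 [dS2 cg2 g20 S201 [S20 S21]]]] := C1_step (r - 2 * h) h0.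
exists h, S1, g1, S2, g2; split=> //; split=> //.
- split=> s; split=> // gs; apply/andP; split; rewrite ltNge; apply/negP => hs;
    move/eqP : gs; apply.
  + by have [] := S10 s ltac:(lra).
  + by have [] := S11 s ltac:(lra).
  + by have [] := S20 s ltac:(lra).
  + by have [] := S21 s ltac:(lra).
- move=> s; split.
    have /andP[? ?] := S101 s; have /andP[? ?] := S201 s.
    (* Up to [r - 3 * h] the falling step [S2] is still 0; beyond it the rising step [S1] is already
       1. *)
    have [sm|sm] := lerP s (r - 2 * h - h).
      by have [-> _] := S20 s sm; lra.
    by have [-> _] := S11 s ltac:(lra); lra.
  move=> ps; apply/andP; split; rewrite leNgt; apply/negP => hs;
    move/eqP : ps; apply.
    by have [-> _] := S10 s ltac:(lra); have [-> _] := S20 s ltac:(lra); lra.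
  by have [-> _] := S11 s ltac:(lra); have [-> _] := S21 s ltac:(lra); lra.
- split=> s hs.
    by have [-> _] := S10 s ltac:(lra); have [-> _] := S20 s ltac:(lra).
  by have [-> _] := S11 s ltac:(lra); have [-> _] := S21 s ltac:(lra).
Qed.

(* Testing with a plateau function that rises near l and falls near r compares
   the averages of Q near l and near r. *)
Lemma weak_derivative_le0 (R : realType) (b c l r : R) (Q q : R -> R) :
  {within `[b, c], continuous Q} ->
  (@lebesgue_measure R).-integrable `]b, c[ (EFin \o Q) ->
  (@lebesgue_measure R).-integrable `]b, c[ (EFin \o q) ->
  weak_derivative b c Q q ->
  b <= l -> l < r -> r <= c ->
  {ae @lebesgue_measure R, forall s, s \in `]l, r[ -> q s <= 0} ->
  Q r <= Q l.
Proof.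
move=> cQ Qi qi Qq bl lr rc q0; rewrite leNgt; apply/negP => QlQr.
have cQlr : {within `[l, r], continuous Q}.
  apply: continuous_subspaceW cQ => s /=; rewrite !in_itv/= => /andP[? ?].
  by apply/andP; split; lra.
have [_ Ql Qr] := (continuous_within_itvP Q lr).1 cQlr.
(* Tolerances of [D / 3] at each end leave a gap of [D / 3] between the values of [Q] near [l] and
   near [r]. *)
pose D := Q r - Q l.
have [e1 e10 He1] : exists2 e : R, 0 < e &
    forall s, l < s -> s < l + e -> Q s < Q l + D / 3.
  have : \forall s \near l^'+, Q s < Q l + D / 3.
    by apply: (cvgr_lt (Q l)) => //; rewrite /D; lra.
  move=> /nbhs_ballP[e /= e0 He]; exists e => // s ls se.
  by apply: He => //; rewrite /ball/= ltr0_norm; lra.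
have [e2 e20 He2] : exists2 e : R, 0 < e &
    forall s, s < r -> r - e < s -> Q r - D / 3 < Q s.
  have : \forall s \near r^'-, Q r - D / 3 < Q s.
    by apply: (cvgr_gt (Q r)) => //; rewrite /D; lra.
  move=> /nbhs_ballP[e /= e0 He]; exists e => // s ls se.
  by apply: He => //; rewrite /ball/= gtr0_norm; lra.
have d0 : 0 < Num.min e1 e2 by rewrite lt_min e10 e20.
have [h [S1 [g1 [S2 [g2 [h0 [[dS1 dS2] [cg1 cg2] [g1P g2P] psiP [S0 S1c]]]]]]]] :=
  C1_plateau lr d0.
have de1 : Num.min e1 e2 <= e1 by rewrite ge_min lexx.
have de2 : Num.min e1 e2 <= e2 by rewrite ge_min lexx orbT.
have bc : b < c by lra.
pose psi s := S1 s - S2 s.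
pose g s := g1 s - g2 s.
have dpsi (s : R) : is_derive s 1 psi (g s) := is_deriveB (dS1 s) (dS2 s).
have cg : continuous g.
  by move=> s; apply: cvgB; [exact: cg1|exact: cg2].
have cpsi := is_derive1_continuous dpsi.
(* [G] dominates [Q g] everywhere: [Q] is below [Q l + D / 3] where [g1] is nonzero and above
   [Q r - D / 3] where [g2] is nonzero. *)
pose G s := (Q l + D / 3) * g1 s + - (Q r - D / 3) * g2 s.
have QG (s : R) : Q s * g s <= G s.
  rewrite /g /G mulrBr mulNr lerB//.
    have [g10 gl] := g1P s; have [->|/gl/andP[ls sl]] := eqVneq (g1 s) 0.
      by rewrite !mulr0.
    by rewrite ler_wpM2r// ltW// He1//; apply: lt_le_trans sl _; rewrite lerD2l.
  have [g20 gr] := g2P s; have [->|/gr/andP[rs sr]] := eqVneq (g2 s) 0.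
    by rewrite !mulr0.
  by rewrite ler_wpM2r// ltW// He2//; apply: le_lt_trans rs; rewrite lerB.
have gE : psi^`()%classic = g.
  by apply/funext => s; rewrite derive1E; have [_ ->] := dpsi s.
have sub : closure [set s | psi s != 0] `<=` `[l + h, r - h].
  have -> : `[l + h, r - h]%classic = closure `[l + h, r - h].
    by apply/closure_id; exact: interval_closed.
  by apply: closureS => s /= /(psiP s).2; rewrite in_itv.
have tpsi : test_function b c psi.
  split.
  - by move=> s; have [] := dpsi s.
  - by rewrite gE.
  - apply: subclosed_compact sub; first exact: closed_closure.
    exact: segment_compact.
  - move=> s /sub /=; rewrite !in_itv/= => /andP[? ?].
    by apply/andP; split; lra.
have := Qq _ tpsi; rewrite gE => E.
have neg : \int[lebesgue_measure]_(s in `]b, c[) (q s * psi s) <= 0.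
  have qpi := integrable_mul_continuous qi cpsi.
  have [mqp _] := integrableP _ _ _ qpi.
  (* The sign of [q] is known almost everywhere only, so the integrand is replaced by [- |q psi|],
     nonpositive at every point. *)
  rewrite /Rintegral (@ae_eq_integral _ _ _ (@lebesgue_measure R) `]b, c[
    (fun s => - `|(q s * psi s)%:E|)%E)//.
  - by rewrite integral_ge0N// fineN oppr_le0 fine_ge0// integral_ge0.
  - by apply: measurableT_comp => //; exact: measurableT_comp.
  - apply: (filterS (Filter := ae_filter_ringOfSetsType _)) q0 => s q0 _.
    rewrite -EFinN; congr EFin.
    have [->|/(psiP s).2/andP[ls sr]] := eqVneq (psi s) 0.
      by rewrite mulr0 normr0 oppr0.
    rewrite ler0_norm ?opprK// mulr_le0_ge0 ?(psiP s).1// q0// in_itv/=.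
    by apply/andP; split; lra.
have : \int[lebesgue_measure]_(s in `]b, c[) (Q s * g s) < 0.
  apply: (@le_lt_trans _ _ (\int[lebesgue_measure]_(s in `]b, c[) G s)).
    apply: le_Rintegral => //.
    - exact: integrable_mul_continuous.
    - apply: continuous_integrable; apply: continuousDf;
        by apply: continuousMf => //; exact: cst_continuous.
  have dG (s : R) : is_derive s 1
      (fun s => (Q l + D / 3) * S1 s + - (Q r - D / 3) * S2 s) (G s) :=
    is_deriveD (is_derive1Zl (Q l + D / 3) (dS1 s))
               (is_derive1Zl (- (Q r - D / 3)) (dS2 s)).
  (* Each step rises from 0 to 1, so the integral of [G] is
     [(Q l + D / 3) - (Q r - D / 3) = - D / 3]. *)
  have -> := @Rintegral_is_derive _ b c _ G bc dG.
    have [-> ->] := S1c c rc; have [-> ->] := S0 b bl.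
    by move: QlQr; rewrite /D; clear; lra.
  apply: continuousDf; by apply: continuousMf => //; exact: cst_continuous.
by rewrite E oppr_lt0 ltNge neg.
Qed.

(* The integrating factor turns the bound k u <= M into the monotonicity of
   (k x + M / a) e^(- a s). *)
Lemma residual_le_growth (R : realType) (a b c l r k M : R) (x v u : R -> R) :
  a != 0 -> W1infty_deriv b c x v ->
  {ae @lebesgue_measure R, forall s, s \in `[b, c] -> v s = a * x s + u s} ->
  b <= l -> l < r -> r <= c ->
  {ae @lebesgue_measure R, forall s, s \in `]l, r[ -> k * u s <= M} ->
  k * x r + M / a <= (k * x l + M / a) * expR (a * (r - l)).
Proof.
move=> a0 [cx Lx Lv xv] vE bl lr rc uM.
have xi := Linfty_integrable Lx; have vi := Linfty_integrable Lv.
pose E0 s : R := expR (- a * s).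
have dE0 (s : R) : is_derive s 1 E0 (- a * E0 s).
  have d : is_derive s 1 (fun r : R => - a * r) (- a).
    by apply: (is_derive_eq (is_derive1Zl (- a) (is_derive_id s 1))); rewrite mulr1.
  by rewrite mulrC; exact: (@is_derive1_comp _ expR _ s _ _ (is_derive_expR _) d).
have cE0 := is_derive1_continuous dE0.
have bc : b < c by exact: le_lt_trans bl (lt_le_trans lr rc).
have ck k' : continuous (fun s => k' * (- a * E0 s)).
  by apply: continuousMf; [exact: cst_continuous|
    apply: continuousMf => //; exact: cst_continuous].
pose Q s := x s * (k * E0 s) + M / a * E0 s.
(* This is the form that [weak_derivative_affine] yields with factor [k * E0] and summand
   [M / a * E0]. *)
pose q s := v s * (k * E0 s) + x s * (k * (- a * E0 s)) + M / a * (- a * E0 s).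
have Qq : weak_derivative b c Q q.
  by apply: (weak_derivative_affine bc (fun s => is_derive1Zl k (dE0 s)) _
    (fun s => is_derive1Zl (M / a) (dE0 s)) _ xi vi xv).
have add := @integrable_add R b c false true.
have ckE k' : continuous (fun s => k' * E0 s).
  by apply: continuousMf => //; exact: cst_continuous.
have Qi : (@lebesgue_measure R).-integrable `]b, c[ (EFin \o Q).
  apply: (add (fun s => x s * (k * E0 s)) (fun s => M / a * E0 s)).
    exact: integrable_mul_continuous.
  exact: continuous_integrable.
have qi : (@lebesgue_measure R).-integrable `]b, c[ (EFin \o q).
  apply: (add (fun s => v s * (k * E0 s) + x s * (k * (- a * E0 s)))
              (fun s => M / a * (- a * E0 s))).
    apply: (add (fun s => v s * (k * E0 s)) (fun s => x s * (k * (- a * E0 s))));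
      exact: integrable_mul_continuous.
  exact: continuous_integrable.
have cQ : {within `[b, c], continuous Q}.
  have cw k' : {within `[b, c], continuous (fun s => k' * E0 s)}.
    exact: continuous_subspaceT.
  move=> s; apply: cvgD; last exact: cw.
  by apply: cvgM; [exact: cx|exact: cw].
have q0 : {ae @lebesgue_measure R, forall s, s \in `]l, r[ -> q s <= 0}.
  apply: (@filterS2 _ _ (ae_filter_ringOfSetsType _) _ _ _ _ vE uM) => s vs us sr.
  (* Once [v s] is replaced by [a * x s + u s], the terms in [x] cancel. *)
  have -> : q s = (k * u s - M) * E0 s.
    rewrite /q vs; last first.
      move: sr; rewrite !in_itv/= => /andP[/ltW ? /ltW ?].
      by apply/andP; split; [exact: le_trans bl _|exact: le_trans rc].
    by field.
  by rewrite mulr_le0_ge0 ?expR_ge0// subr_le0 us.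
have := weak_derivative_le0 cQ Qi qi Qq bl lr rc q0.
have QE s : Q s = (k * x s + M / a) * E0 s by rewrite /Q; ring.
have -> : expR (a * (r - l)) = E0 l / E0 r.
  by rewrite /E0 -expRN -expRD; congr expR; ring.
by rewrite !QE mulrA ler_pdivlMr// expR_gt0.
Qed.

(** * Lower bound and uniqueness on one stage *)

(** This is variation of constants with a constant forcing term. The factor [(e^(a d) - 1) / a],
    with [d] the stage length, is the integral of [e^(a s)] over [[0, d]], hence positive for either
    sign of [a]. *)
Lemma stage_residualE (R : realType) (a : R) (t z : nat -> R) (i : nat) :
  a != 0 -> t i < t i.+1 ->
  z i.+1 - expR (a * (t i.+1 - t i)) * z i =
  stage_residual a t z i * ((expR (a * (t i.+1 - t i)) - 1) / a) /\
  0 < (expR (a * (t i.+1 - t i)) - 1) / a.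
Proof.
move=> a0 tt; have d0 : 0 < t i.+1 - t i by rewrite subr_gt0.
have pos : 0 < (expR (a * (t i.+1 - t i)) - 1) / a.
  move: a0; rewrite neq_lt => /orP[a0|a0].
    by rewrite nmulr_lgt0 ?invr_lt0// subr_lt0 expR_lt1 nmulr_rlt0.
  by rewrite divr_gt0// subr_gt0 expR_gt1 mulr_gt0.
split=> //; rewrite /stage_residual; field.
(* A zero denominator [1 - e^(a d)] would turn [pos] into [0 < 0]. *)
rewrite a0/= subr_eq0; apply: contraTneq pos => <-.
by rewrite subrr mul0r ltxx.
Qed.

Lemma stage_residual_le_ess_norm (R : realType) (a b c : R) (t z : nat -> R)
    (i : nat) (x v u : R -> R) :
  a != 0 -> W1infty_deriv b c x v ->
  {ae @lebesgue_measure R, forall s, s \in `[b, c] -> v s = a * x s + u s} ->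
  b <= t i -> t i < t i.+1 -> t i.+1 <= c ->
  x (t i) = z i -> x (t i.+1) = z i.+1 ->
  (`|stage_residual a t z i|%:E <= ess_norm `[t i, t i.+1] u)%E.
Proof.
move=> a0 W vE bt tt tc xi xi1.
have [zE pos] := stage_residualE z a0 tt.
(* The estimate is first proved for real almost-everywhere bounds; the infinite values of the
   essential norm are treated afterwards. *)
have bound M : {ae @lebesgue_measure R,
    forall s, s \in `[t i, t i.+1] -> (`|u s|%:E <= M%:E)%E} ->
    `|stage_residual a t z i| <= M.
  move=> uM.
  have sgn k : (k = 1 \/ k = -1) -> k * stage_residual a t z i <= M.
    (* Multiplied by the positive factor of [stage_residualE], the claim becomes the growth bound
       over the whole stage. *)
    move=> k1; rewrite -(ler_pM2r pos) -mulrA -zE.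
    have H : k * z i.+1 + M / a <=
        (k * z i + M / a) * expR (a * (t i.+1 - t i)).
      rewrite -xi -xi1; apply: (residual_le_growth a0 W vE) => //.
      apply: (filterS (Filter := ae_filter_ringOfSetsType _)) uM.
      move=> s us sr; have := us (subset_itv_oo_cc sr); rewrite lee_fin.
      move=> /(le_trans _); apply.
      case: k1 => ->; rewrite ?mul1r ?mulN1r; first exact: ler_norm.
      by rewrite -normrN ler_norm.
    rewrite -subr_ge0.
    have -> : M * ((expR (a * (t i.+1 - t i)) - 1) / a)
        - k * (z i.+1 - expR (a * (t i.+1 - t i)) * z i) =
      (k * z i + M / a) * expR (a * (t i.+1 - t i)) - (k * z i.+1 + M / a).
      by field.
    by rewrite subr_ge0.
  rewrite ler_norml; apply/andP; split.
    by rewrite lerNl -mulN1r sgn//; right.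
  by rewrite -[leLHS]mul1r sgn//; left.
rewrite leNgt; apply/negP => lt.
have /(_ (lexx _)) := (@ess_normP _ `[t i, t i.+1] u (ess_norm `[t i, t i.+1] u)).1.
move: lt; case: (ess_norm _ _) => [M||]//.
  by rewrite lte_fin ltNge => /negP lt /bound.
(* If the essential norm were [-oo], every real number would be a bound; [-1] contradicts the sign
   of an absolute value. *)
move=> _ uN.
have := normr_ge0 (stage_residual a t z i); apply/negP; rewrite -ltNge.
apply: (@le_lt_trans _ _ (-1)); last by rewrite ltrN10.
apply: bound.
by apply: (filterS (Filter := ae_filter_ringOfSetsType _)) uN => s /[apply].
Qed.

(** The growth bound is applied from [t i] to the point [s] itself, with [M = k ubar] for both signs
    [k]; the two inequalities are opposite. *)
Lemma stage_residual_unique (R : realType) (a b c : R) (t z : nat -> R)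
    (i : nat) (x v u : R -> R) :
  a != 0 -> W1infty_deriv b c x v ->
  {ae @lebesgue_measure R, forall s, s \in `[b, c] -> v s = a * x s + u s} ->
  b <= t i -> t i.+1 <= c -> x (t i) = z i ->
  (forall s, s \in `]t i, t i.+1[ -> u s = stage_residual a t z i) ->
  forall s, s \in `[t i, t i.+1] -> x s = stage_interpolant a t z i s.
Proof.
move=> a0 W vE bt tc xi uE s; rewrite in_itv/= => /andP[ts st].
(* The growth bound requires [l < r], so the left node is settled separately. *)
rewrite /stage_interpolant; move: ts; rewrite le_eqVlt => /predU1P[<-|ts].
  by rewrite subrr mulr0 expR0 mulr1 addrK.
have bound k : k * x s + k * stage_residual a t z i / a <=
    (k * x (t i) + k * stage_residual a t z i / a) * expR (a * (s - t i)).
  apply: (residual_le_growth a0 W vE) => //; first exact: le_trans tc.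
  apply: aeW => r; rewrite in_itv/= => /andP[tr rs].
  by rewrite uE// in_itv/= tr (lt_le_trans rs).
have := bound 1; have := bound (-1); rewrite xi !mul1r !mulN1r.
set e := expR _; set w := stage_residual a t z i; move=> H1 H2.
apply/eqP; rewrite eq_le; apply/andP; split; first by lra.
by move: H1; rewrite mulNr -opprD -opprD mulNr lerN2; lra.
Qed.

(** * Gluing the stage formulas into a feasible pair *)

Lemma stage_interpolant_start (R : realType) (a : R) (t z : nat -> R) (i : nat) :
  stage_interpolant a t z i (t i) = z i.
Proof. by rewrite /stage_interpolant subrr mulr0 expR0 mulr1 addrK. Qed.

Lemma stage_interpolant_end (R : realType) (a : R) (t z : nat -> R) (i : nat) :
  a != 0 -> t i < t i.+1 -> stage_interpolant a t z i (t i.+1) = z i.+1.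
Proof.
move=> a0 tt; have [+ _] := stage_residualE z a0 tt.
rewrite /stage_interpolant; set w := stage_residual _ _ _ _.
set e := expR _ => zE.
rewrite -[z i.+1](subrK (e * z i)) zE; by field.
Qed.

Lemma is_derive_stage_interpolant (R : realType) (a : R) (t z : nat -> R)
    (i : nat) (s : R) : a != 0 ->
  is_derive s 1 (stage_interpolant a t z i)
    (a * stage_interpolant a t z i s + stage_residual a t z i).
Proof.
move=> a0.
have d : is_derive s 1 (fun r : R => a * (r + - t i)) a.
  have d1 := is_deriveD (is_derive_id s 1) (is_derive_cst (- t i : R^o) s 1).
  by apply: (is_derive_eq (is_derive1Zl a d1)); rewrite addr0 mulr1.
have d2 := is_derive1Zl (z i + stage_residual a t z i / a)
  (@is_derive1_comp _ expR _ s _ _ (is_derive_expR _) d).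
apply: (is_derive_eq (is_deriveB d2
  (is_derive_cst (stage_residual a t z i / a : R^o) s 1))).
by rewrite subr0 /stage_interpolant /=; field.
Qed.

Lemma le_nodes (R : realType) (N : nat) (t : nat -> R) :
  (forall i : nat, (i < N)%N -> t i < t i.+1) ->
  forall i j : nat, (i <= j)%N -> (j <= N)%N -> t i <= t j.
Proof.
move=> tt i; elim=> [|j IH].
  by rewrite leqn0 => /eqP ->.
rewrite leq_eqVlt => /predU1P[<-//|]; rewrite ltnS => ij jN.
by apply: le_trans (IH ij (ltnW jN)) _; exact/ltW/tt.
Qed.

(** The stages are appended one at a time, by composing with [Num.min] and [Num.max]: continuity on
    the whole line then needs no case analysis at the nodes. *)
Lemma continuous_interpolant (R : realType) (a : R) (N : nat) (t z : nat -> R) :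
  a != 0 -> (forall i : nat, (i < N)%N -> t i < t i.+1) ->
  exists2 x : R -> R, continuous x & forall i : nat, (i < N)%N ->
    forall s : R, s \in `[t i, t i.+1] -> x s = stage_interpolant a t z i s.
Proof.
move=> a0 tt.
(* The value at the last node is part of the induction, since it is where the next stage is
   attached. *)
suff H n : (n <= N)%N -> exists2 x : R -> R, continuous x & x (t n) = z n /\
    forall i : nat, (i < n)%N ->
    forall s : R, s \in `[t i, t i.+1] -> x s = stage_interpolant a t z i s.
  by have [x cx [_ xP]] := H N (leqnn N); exists x.
elim: n => [_|n IH nN].
  by exists (fun=> z 0%N) => // s; exact: cst_continuous.
have [x cx [xn xP]] := IH (ltnW nN).
(* Left of [t n] the second summand is 0; right of it the first one is frozen at [z n] and cancels
   [- z n]. *)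
exists (fun s => x (Num.min s (t n))
    + (stage_interpolant a t z n (Num.max s (t n)) - z n)).
  have cI : continuous (stage_interpolant a t z n).
    apply: is_derive1_continuous => s; exact: is_derive_stage_interpolant.
  move=> s; apply: cvgD.
    apply: (@continuous_comp _ _ _ (fun s => Num.min s (t n)) x); last exact: cx.
    by apply: (@continuous_min _ _ id (fun=> t n) s); [exact: cvg_id|exact: cvg_cst].
  apply: cvgB; last exact: cvg_cst.
  apply: (@continuous_comp _ _ _ (fun s => Num.max s (t n))); last exact: cI.
  by apply: (@continuous_max _ _ id (fun=> t n) s); [exact: cvg_id|exact: cvg_cst].
split.
  have tn := ltW (tt n nN).
  by rewrite min_r// max_l// xn stage_interpolant_end ?tt// addrC subrK.
move=> i; rewrite ltnS leq_eqVlt => /predU1P[->|lin] s;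
    rewrite in_itv/= => /andP[si si1].
  by rewrite min_r// max_l// xn addrC subrK.
have sn : s <= t n by apply: le_trans si1 _; apply: (le_nodes tt) => //; exact: ltnW.
rewrite min_l// max_r// stage_interpolant_start subrr addr0.
by apply: xP => //; rewrite in_itv/= si.
Qed.

(** The values of [u] at the nodes are arbitrary, but there are finitely many of them. Each step of
    the induction adds an open stage, where [u] is constant, and its right node. *)
Lemma piecewise_constant_bounded (R : realType) (N : nat) (t w : nat -> R)
    (u : R -> R) :
  (forall i : nat, (i < N)%N -> t i < t i.+1) ->
  (forall i : nat, (i < N)%N ->
    forall s : R, s \in `]t i, t i.+1[ -> u s = w i) ->
  measurable_fun `[t 0%N, t N] u /\
  exists M : R, forall s, s \in `[t 0%N, t N] -> `|u s| <= M.
Proof.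
move=> tt uw.
suff H n : (n <= N)%N -> measurable_fun `[t 0%N, t n] u /\
  exists M : R, forall s, s \in `[t 0%N, t n] -> `|u s| <= M by exact: H.
elim: n => [_|n IH nN].
  rewrite set_itv1; split; first exact: measurable_fun_set1.
  by exists `|u (t 0%N)| => s; rewrite itvxx inE => /eqP ->.
have [mu [M uM]] := IH (ltnW nN).
have split_itv s : s \in `[t 0%N, t n.+1] ->
    [\/ s \in `[t 0%N, t n], s \in `]t n, t n.+1[ | s = t n.+1].
  rewrite !in_itv/= => /andP[-> /=]; rewrite le_eqVlt => /predU1P[->|sn].
    by constructor 3.
  by have [ns|ns] := lerP s (t n); [constructor 1|constructor 2; rewrite ?ns].
split.
  have -> : `[t 0%N, t n.+1]%classic =
      `[t 0%N, t n] `|` (`]t n, t n.+1[ `|` [set t n.+1]).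
    have t0n := le_nodes tt (leq0n n) (ltnW nN); have tn := tt n nN.
    apply/seteqP; split=> s /=.
      by move=> /split_itv[]; [left|right; left|right; right].
    rewrite !in_itv/= => -[/andP[-> sn]|[/andP[/ltW ns /ltW ->]|->]].
    - by rewrite (le_trans sn (ltW tn)).
    - by rewrite (le_trans t0n ns).
    - by rewrite lexx andbT (le_trans t0n (ltW tn)).
  apply/measurable_funU => //; first exact: measurableU.
  split=> //; apply/measurable_funU => //; split; last exact: measurable_fun_set1.
  by apply: eq_measurable_fun (measurable_cst (w n)) => s; rewrite inE => /(uw n nN).
exists (Num.max M (Num.max `|w n| `|u (t n.+1)|)) => s.
move=> /split_itv[/uM|/(uw n nN) ->|->];
  by rewrite !le_max ?lexx ?orbT// => ->.
Qed.

Lemma bounded_Linfty (R : realType) (i : interval R) (f : R -> R) (M : R) :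
  measurable_fun [set` i] f -> (forall s, s \in i -> `|f s| <= M) -> Linfty i f.
Proof.
move=> mf fM; split=> //; apply: (@le_lt_trans _ _ M%:E); last exact: ltry.
by apply/ess_normP; apply: aeW => s /fM; rewrite lee_fin.
Qed.

(** Inside each stage [x phi' + (a x + u) phi] is the classical derivative of [x phi]. The stage
    integrals telescope by continuity of [x], and [phi] vanishes at the two outer nodes. *)
Lemma interpolant_weak_derivative (R : realType) (a : R) (N : nat)
    (t z : nat -> R) (x u : R -> R) :
  a != 0 -> (forall i : nat, (i < N)%N -> t i < t i.+1) ->
  continuous x ->
  (@lebesgue_measure R).-integrable `]t 0%N, t N] (EFin \o u) ->
  (forall i : nat, (i < N)%N -> forall s : R, s \in `]t i, t i.+1[ ->
    u s = stage_residual a t z i) ->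
  (forall i : nat, (i < N)%N -> forall s : R, s \in `[t i, t i.+1] ->
    x s = stage_interpolant a t z i s) ->
  weak_derivative (t 0%N) (t N) x (fun s => a * x s + u s).
Proof.
move=> a0 tt cx ui uE xE phi tphi; have [dphi cphi _ _] := tphi.
have dphi' (s : R) : is_derive s 1 phi (phi^`()%classic s).
  by rewrite derive1E; apply: derivableP.
have cp := is_derive1_continuous dphi'.
pose f s := x s * phi^`()%classic s + (a * x s + u s) * phi s.
(* The flags select intervals open on the left and closed on the right, so that consecutive stages
   are disjoint with no gap. *)
have add := @integrable_add R (t 0%N) (t N) false false.
have cax : continuous (fun s => a * x s).
  by apply: continuousMf => //; exact: cst_continuous.
have xphi : (@lebesgue_measure R).-integrable `]t 0%N, t N]
    (EFin \o (fun s => x s * phi^`()%classic s)).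
  by apply: continuous_integrable; exact: continuousMf.
have vphi : (@lebesgue_measure R).-integrable `]t 0%N, t N]
    (EFin \o (fun s => (a * x s + u s) * phi s)).
  apply: integrable_mul_continuous => //.
  by apply: (add _ _ _ ui); exact: continuous_integrable.
have fi : (@lebesgue_measure R).-integrable `]t 0%N, t N] (EFin \o f).
  exact: (add _ _ xphi vphi).
have xt0 i : (i < N)%N -> x (t i) = z i.
  move=> iN; rewrite (xE i iN) ?stage_interpolant_start//.
  by rewrite in_itv/= lexx ltW ?tt.
have xt1 i : (i < N)%N -> x (t i.+1) = z i.+1.
  move=> iN; rewrite (xE i iN) ?stage_interpolant_end ?tt//.
  by rewrite in_itv/= lexx ltW ?tt.
have stage i : (i < N)%N -> \int[lebesgue_measure]_(s in `]t i, t i.+1]) f s =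
    x (t i.+1) * phi (t i.+1) - x (t i) * phi (t i).
  move=> iN; rewrite -Rintegral_itv_bndo_bndc; last first.
    apply: integrableS fi => //; apply: subset_itv; rewrite bnd_simp.
      exact: (le_nodes tt) (ltnW iN).
    by apply: (le_nodes tt).
  pose I := stage_interpolant a t z i.
  have dI (s : R) := is_derive_stage_interpolant t z i s a0.
  have cI := is_derive1_continuous dI.
  pose w := stage_residual a t z i.
  (* On the open stage [x] and [u] are replaced by their formulas, which are differentiable on the
     whole line as [Rintegral_is_derive] requires. *)
  transitivity (\int[lebesgue_measure]_(s in `]t i, t i.+1[)
      (I s * phi^`()%classic s + (a * I s + w) * phi s)).
    apply: eq_Rintegral => s; rewrite inE /= => si.
    by rewrite /f (uE i)// (xE i)//; exact: subset_itv_oo_cc.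
  rewrite (Rintegral_is_derive (tt i iN) (fun s => is_derive1M (dI s) (dphi' s))).
    rewrite (xt0 i iN) (xt1 i iN) stage_interpolant_start.
    by rewrite stage_interpolant_end// tt.
  apply: continuousDf; apply: continuousMf => //.
  apply: continuousDf; last exact: cst_continuous.
  by apply: continuousMf => //; exact: cst_continuous.
have telescope n : (n <= N)%N ->
    \int[lebesgue_measure]_(s in `]t 0%N, t n]) f s =
    x (t n) * phi (t n) - x (t 0%N) * phi (t 0%N).
  elim: n => [_|n IH nN].
    by rewrite set_itv_ge ?bnd_simp ?ltxx// Rintegral_set0 subrr.
  have t0n := le_nodes tt (leq0n n) (ltnW nN).
  have tn := ltW (tt n nN).
  have fin : (@lebesgue_measure R).-integrable `]t 0%N, t n.+1] (EFin \o f).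
    apply: integrableS fi => //.
    by apply: subset_itvl; rewrite bnd_simp (le_nodes tt).
  have := @Rintegral_itvB _ f (BRight (t 0%N)) (BRight (t n.+1)) (t n) fin.
  rewrite !bnd_simp => /(_ t0n tn); rewrite IH ?(ltnW nN)// stage// => H.
  by move: H => /eqP; rewrite subr_eq => /eqP ->; ring.
have sub : `]t 0%N, t N[ `<=` `]t 0%N, t N] by exact: subset_itv_oo_oc.
have oo g : (@lebesgue_measure R).-integrable `]t 0%N, t N] (EFin \o g) ->
    (@lebesgue_measure R).-integrable `]t 0%N, t N[ (EFin \o g).
  by move=> gi; apply: integrableS gi.
apply/eqP; rewrite -addr_eq0; apply/eqP; rewrite -RintegralD ?oo//.
rewrite Rintegral_itv_bndo_bndc ?oo// telescope//.
by rewrite !(test_function_eq0 tphi) ?in_itv/= ?ltxx ?andbF// !mulr0 subrr.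
Qed.

(** The two end points, where [u] is not prescribed, form a null set. *)
Lemma ess_norm_stage_le (R : realType) (b c w : R) (u : R -> R) :
  (forall s, s \in `]b, c[ -> u s = w) -> (ess_norm `[b, c] u <= `|w|%:E)%E.
Proof.
move=> uw; apply/ess_normP.
have ne (d : R) : {ae @lebesgue_measure R, forall s, s != d}.
  exists [set d]; split; [by []|exact: lebesgue_measure_set1|].
  by move=> s /= /negP; rewrite negbK => /eqP.
apply: (@filterS2 _ _ (ae_filter_ringOfSetsType _) _ _ _ _ (ne b) (ne c)).
move=> s sb sc; rewrite in_itv/= => /andP[bs cs].
by rewrite uw// in_itv/= !lt_neqAle bs cs sc eq_sym sb.
Qed.

(* u is prescribed on the open stages only: it may jump at the nodes, where
   its values are immaterial. *)
Theorem proposition2 (R : realType) (N : nat) (N_gt0 : (0 < N)%N)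
    (t z : nat -> R) (t0 : t 0%N = 0)
    (t_incr : forall i : nat, (i < N)%N -> t i < t i.+1)
    (z_neq : forall i : nat, (i < N)%N -> z i.+1 != z i)
    (a : R) (a_neq0 : a != 0)
    (u : R -> R)
    (u_stage : forall i : nat, (i < N)%N ->
      forall s : R, s \in `]t i, t i.+1[ -> u s = stage_residual a t z i) :
  (exists x : R -> R, PLinf_solution (fun y _ => a * y) N t z x u) /\
  (forall x : R -> R, PLinf_feasible (fun y _ => a * y) N t z x u ->
    forall i : nat, (i < N)%N ->
    forall s : R, s \in `[t i, t i.+1] -> x s = stage_interpolant a t z i s).
Proof.
have le_t := le_nodes t_incr.
split; last first.
  move=> x [[v W vE] _ xz] i iN.
  apply: (stage_residual_unique a_neq0 W vE); rewrite ?le_t ?xz ?(ltnW iN)//.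
  exact: u_stage.
have [x cx xE] := continuous_interpolant z a_neq0 t_incr.
have [mu [M uM]] := piecewise_constant_bounded t_incr u_stage.
exists x; split; last first.
  (* Optimality holds term by term: on stage [i], [|ubar|] lies between the essential norms of [u]
     and of the competitor [v]. *)
  move=> y v [[w W wE] _ yz]; apply: lee_sum => i _.
  apply: le_trans (ess_norm_stage_le (u_stage i (ltn_ord i))) _.
  apply: (stage_residual_le_ess_norm a_neq0 W wE); rewrite ?le_t ?t_incr ?yz//;
    exact: ltnW.
have sub : `]t 0%N, t N[ `<=` `[t 0%N, t N] by exact: subset_itv_oo_cc.
have Lu : Linfty `]t 0%N, t N[ u.
  apply: (@bounded_Linfty _ _ _ M); first exact: measurable_funS mu.
  by move=> s /sub; exact: uM.
have [X xX] : exists X : R, forall s, s \in `[t 0%N, t N] -> `|x s| <= X.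
  have cabs : {within `[t 0%N, t N], continuous (fun s => `|x s|)}.
    by apply: continuous_subspaceT => s; apply: cvg_norm; exact: cx.
  have [s _ sX] := EVT_max (le_t _ _ (leq0n N) (leqnn N)) cabs.
  by exists `|x s|.
have mx : measurable_fun setT x by exact: continuous_measurable_fun.
split=> //.
(* With this choice of weak derivative the differential equation holds at every point. *)
- exists (fun s => a * x s + u s); last exact: aeW.
  split.
  + exact: continuous_subspaceT.
  + apply: (@bounded_Linfty _ _ _ X); first exact: measurable_funTS.
    by move=> s /sub; exact: xX.
  + apply: (@bounded_Linfty _ _ _ (`|a| * X + M)).
      apply: measurable_funD; last exact: measurable_funS mu.
      by apply: measurable_funTS; exact: measurable_funM.
    move=> s /sub si; apply: le_trans (ler_normD _ _) _.
    by rewrite lerD ?uM// normrM ler_wpM2l ?xX.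
  + apply: (interpolant_weak_derivative a_neq0 t_incr cx _ u_stage xE).
    apply: measurable_bounded_integrable => //.
    * by rewrite /= lebesgue_measure_itv/=; case: ifP => //; rewrite -EFinB ltry.
    * by apply: measurable_funS mu => //; exact: subset_itv_oc_cc.
    * exists M; split; first exact: num_real.
      move=> r Mr s /= /subset_itv_oc_cc si.
      by apply: le_trans (uM s si) _; exact: ltW.
(* Node 0 is the start of stage 0, which exists because [0 < N]; node [i.+1] is the end of stage
   [i]. *)
- case=> [|i] iN.
    rewrite (xE 0%N)// ?stage_interpolant_start// in_itv/= lexx ltW//.
    exact: t_incr.
  rewrite (xE i)// ?stage_interpolant_end ?t_incr// in_itv/= lexx andbT ltW//.
  exact: t_incr.
Qed.
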